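(* The class $\mathcal S_i$ of all semitopological isomorphisms is closed under pullback with respect to continuous injective homomorphisms; that is: if $f:(G,\tau)\to(H,\sigma)$ is a semitopological isomorphism of topological groups and $j:(K,\sigma')\to(H,\sigma)$ is a continuous injective homomorphism of topological groups, then the projection $P\to(K,\sigma')$, $(g,k)\mapsto k$, from the pullback $P=\{(g,k)\in G\times K: f(g)=j(k)\}$ (endowed with the topology inherited from $(G,\tau)\times(K,\sigma')$) is a semitopological isomorphism.
   Context: Topological groups are not assumed Hausdorff. A continuous isomorphism is a bijective continuous homomorphism (its inverse need not be continuous). A continuous isomorphism $f:(G,\tau)\to(H,\sigma)$ of topological groups is semitopological (a semitopological isomorphism) if there exist a topological group $(\widetilde G,\widetilde\tau)$ containing $G$ as a topological normal subgroup (i.e. $G$ is, up to identification, a normal subgroup of $\widetilde G$ and $\widetilde\tau\restriction_G=\tau$) and an open continuous homomorphism $\widetilde f:(\widetilde G,\widetilde\tau)\to(H,\sigma)$ extending $f$. *)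

(* Defs.v *)
From HB Require Import structures.
From mathcomp Require Import all_boot all_classical topology.

Set Implicit Arguments.
Unset Strict Implicit.
Unset Printing Implicit Defensive.

Local Open Scope classical_set_scope.
Local Open Scope group_scope.

(* No separation axiom is imposed. *)
HB.mixin Record isTopologicalGroup G of monoid.Group G & Topological G := {
  mulg_continuous : continuous (fun x : G * G => x.1 * x.2) ;
  invg_continuous : continuous (fun x : G => x^-1)
}.

#[short(type="topologicalGroupType")]
HB.structure Definition TopologicalGroup :=
  {G of monoid.Group G & Topological G & isTopologicalGroup G}.

Notation "{ 'ghom' G -> H }" := (UMagmaMorphism.type G%type H%type)
  (at level 0, G at level 98, H at level 99, format "{ 'ghom'  G  ->  H }")
  : type_scope.

Definition normal_subgroup (G : groupType) (N : set G) : Prop :=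
  [/\ N 1%g,
      (forall x y : G, N x -> N y -> N (x / y)) &
      (forall x g : G, N x -> N (x ^ g))].

Definition open_map (X Y : topologicalType) (f : X -> Y) : Prop :=
  forall U : set X, open U -> open (f @` U).

(* [i] is a homeomorphism onto its image with the subspace topology. *)
Definition topological_embedding (X Y : topologicalType) (i : X -> Y) : Prop :=
  injective i /\
  (forall U : set X, open U <-> exists2 V : set Y, open V & i @^-1` V = U).

Definition continuous_isomorphism (G H : topologicalGroupType)
    (f : {ghom G -> H}) : Prop :=
  bijective f /\ continuous f.

(* [i] identifies [G] with a topological normal subgroup of [G']. *)
Definition semitopological_isomorphism (G H : topologicalGroupType)
    (f : {ghom G -> H}) : Prop :=
  continuous_isomorphism f /\
  exists (G' : topologicalGroupType) (i : {ghom G -> G'}) (f' : {ghom G' -> H}),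
    [/\ topological_embedding i,
        normal_subgroup (range i),
        continuous f',
        open_map f' &
        forall x : G, f' (i x) = f x].

Lemma comp_continuous (X Y Z : topologicalType) (g : X -> Y) (h : Y -> Z) :
  continuous g -> continuous h -> continuous (fun x => h (g x)).
Proof. by move=> cg ch x; apply: continuous_comp; [exact: cg|exact: ch]. Qed.

Lemma pair_continuous (X Y Z : topologicalType) (g : X -> Y) (h : X -> Z) :
  continuous g -> continuous h -> continuous (fun x => (g x, h x)).
Proof. by move=> cg ch x; apply: cvg_pair; [exact: cg|exact: ch]. Qed.

Section Pullback.
Context {G H K : topologicalGroupType}.
Variables (f : {ghom G -> H}) (j : {ghom K -> H}).

Definition pullback_set : set (G * K) := [set x | f x.1 = j x.2].

Definition pullback : Type := set_type pullback_set.

HB.instance Definition _ := SubChoice.on pullback.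
HB.instance Definition _ := Topological.copy pullback (set_type pullback_set).

Lemma pullback_group_closed :
  group_closed (fun x : G * K => x \in pullback_set).
Proof.
split=> [|x y]; first by apply/mem_set; rewrite /pullback_set /= !gmulf1.
move=> /set_mem/= fx /set_mem/= fy; apply/mem_set => /=.
by rewrite /pullback_set /= !gmulfF fx fy.
Qed.

HB.instance Definition _ :=
  SubChoice_isSubGroup.Build (G * K)%type _ pullback
    pullback_group_closed.

Lemma val_pullback_continuous : continuous (val : pullback -> G * K).
Proof. exact: initial_continuous. Qed.

Lemma pullback_continuous (X : topologicalType) (h : X -> pullback) :
  continuous (val \o h) -> continuous h.
Proof.
move=> /continuousP vh; apply/continuousP => _ [B oB <-].
by rewrite -comp_preimage; exact: vh.
Qed.

Lemma pullback_mulg_continuous :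
  continuous (fun x : pullback * pullback => x.1 * x.2).
Proof.
have v1 : continuous (fun y : pullback * pullback => val y.1).
  apply: (@comp_continuous _ _ _ fst (val : pullback -> G * K)).
    by move=> ?; exact: cvg_fst.
  exact: val_pullback_continuous.
have v2 : continuous (fun y : pullback * pullback => val y.2).
  apply: (@comp_continuous _ _ _ snd (val : pullback -> G * K)).
    by move=> ?; exact: cvg_snd.
  exact: val_pullback_continuous.
apply: pullback_continuous.
apply: (@pair_continuous _ _ _
  (fun y : pullback * pullback => (val y.1).1 * (val y.2).1)
  (fun y : pullback * pullback => (val y.1).2 * (val y.2).2)).
- apply: (@comp_continuous _ _ _
    (fun y : pullback * pullback => ((val y.1).1, (val y.2).1))
    (fun y : G * G => y.1 * y.2)); last exact: mulg_continuous.
  apply: pair_continuous.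
    by apply: (comp_continuous v1) => ?; exact: cvg_fst.
  by apply: (comp_continuous v2) => ?; exact: cvg_fst.
- apply: (@comp_continuous _ _ _
    (fun y : pullback * pullback => ((val y.1).2, (val y.2).2))
    (fun y : K * K => y.1 * y.2)); last exact: mulg_continuous.
  apply: pair_continuous.
    by apply: (comp_continuous v1) => ?; exact: cvg_snd.
  by apply: (comp_continuous v2) => ?; exact: cvg_snd.
Qed.

Lemma pullback_invg_continuous : continuous (fun x : pullback => x^-1).
Proof.
have v := val_pullback_continuous.
apply: pullback_continuous.
apply: (@pair_continuous _ _ _
  (fun y : pullback => (val y).1^-1) (fun y : pullback => (val y).2^-1)).
- apply: (@comp_continuous _ _ _ (fun y : pullback => (val y).1)
    (fun y : G => y^-1)); last exact: invg_continuous.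
  by apply: (comp_continuous v) => ?; exact: cvg_fst.
- apply: (@comp_continuous _ _ _ (fun y : pullback => (val y).2)
    (fun y : K => y^-1)); last exact: invg_continuous.
  by apply: (comp_continuous v) => ?; exact: cvg_snd.
Qed.

HB.instance Definition _ := isTopologicalGroup.Build pullback
  pullback_mulg_continuous pullback_invg_continuous.

Definition pullback_proj (x : pullback) : K := (val x).2.

Lemma pullback_projF : {morph pullback_proj : x y / x / y}.
Proof. by []. Qed.

HB.instance Definition _ :=
  isGroupMorphism.Build pullback K pullback_proj pullback_projF.

End Pullback.

Arguments pullback_proj {G H K} f j x.

(* Main.v *)
Require Import Defs.
From HB Require Import structures.
From mathcomp Require Import all_boot all_classical topology.

(** Pulling back preserves the witness of semitopologicity.  Let [f] be
    extended along [i : G -> G'] to an open continuous homomorphism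
    [f' : G' -> H].  The pullback of [f'] along [j] is again a topological
    group, and its projection to [K] extends the projection of the pullback of
    [f] once the latter is embedded by [(g, k) |-> (i g, k)].  Two facts make
    this extension a witness: open maps are stable under pullback along a
    continuous map ([pullback_proj_open]), and [i] times the identity of [K]
    is an embedding that restricts to one between the pullbacks
    ([pullback_map_embedding]).  The image of the embedding is the trace on
    the large pullback of [range i] times [K], hence it is normal
    ([pullback_map_normal]).  The projection to [K] is bijective because [f]
    is: its inverse is [k |-> (f^-1 (j k), k)]. *)

Set Implicit Arguments.
Unset Strict Implicit.
Unset Printing Implicit Defensive.

Local Open Scope classical_set_scope.
Local Open Scope group_scope.

Section PullbackProjection.
Context {G H K : topologicalGroupType}.
Variables (f : {ghom G -> H}) (j : {ghom K -> H}).

Lemma pullbackP (x : pullback f j) : f (val x).1 = j (val x).2.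
Proof. exact: set_mem (valP x). Qed.

Definition pullback_mk (g : G) (k : K) (e : f g = j k) : pullback f j :=
  exist _ (g, k) (mem_set (e : pullback_set f j (g, k))).

Lemma pullback_proj_continuous : continuous (pullback_proj f j).
Proof.
apply: (comp_continuous (@val_pullback_continuous _ _ _ f j)).
by move=> ?; exact: cvg_snd.
Qed.

Lemma pullback_proj_bij : bijective f -> bijective (pullback_proj f j).
Proof.
case=> finv fK finvK.
exists (fun k => pullback_mk (finvK (j k))) => [x|//].
by apply: val_inj; apply: injective_projections; rewrite //= -pullbackP fK.
Qed.

(** The image of the trace of a rectangle [A `*` B] is
    [j @^-1` (f @` A) `&` B], which is a neighbourhood whenever [A] and [B]
    are. *)
Lemma pullback_proj_open :
  open_map f -> continuous j -> open_map (pullback_proj f j).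
Proof.
move=> fo jc _ [W oW <-]; rewrite openE => _ [x Wx <-].
have [[A B] [/= nA nB] AB] : nbhs (val x) W by exact: open_nbhs_nbhs.
have nfA : nbhs (pullback_proj f j x) (j @^-1` (f @` A°)).
  apply: jc; apply: open_nbhs_nbhs; split; first exact/fo/open_interior.
  by exists (val x).1; [exact: nA | exact: pullbackP].
apply: filterS (filterI nfA nB) => k [[g gA e] Bk].
exists (pullback_mk e) => //=.
by apply: AB; split=> //; exact: interior_subset gA.
Qed.

End PullbackProjection.

Lemma embedding_continuous (X Y : topologicalType) (h : X -> Y) :
  topological_embedding h -> continuous h.
Proof. by case=> _ ho; apply/continuousP => V oV; apply/ho; exists V. Qed.

Section PullbackMap.
Context {G G' H K : topologicalGroupType}.
Variables (f : {ghom G -> H}) (f' : {ghom G' -> H}) (j : {ghom K -> H}).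
Variables (i : {ghom G -> G'}) (f'i : forall x, f' (i x) = f x).

Definition pullback_map (x : pullback f j) : pullback f' j :=
  pullback_mk (etrans (f'i (val x).1) (pullbackP x)).

Lemma pullback_mapF : {morph pullback_map : x y / x / y}.
Proof.
by move=> x y; apply: val_inj; apply: injective_projections => //=;
  rewrite gmulfF.
Qed.

HB.instance Definition _ :=
  isGroupMorphism.Build (pullback f j) (pullback f' j) pullback_map
    pullback_mapF.

Lemma pullback_map_continuous : continuous i -> continuous pullback_map.
Proof.
move=> ic; have v := @val_pullback_continuous _ _ _ f j.
apply: pullback_continuous.
apply: (@pair_continuous _ _ _
  (fun x : pullback f j => i (val x).1) (fun x : pullback f j => (val x).2)).
- apply: (@comp_continuous _ _ _ (fun x : pullback f j => (val x).1) i) => //.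
  by apply: (comp_continuous v) => ?; exact: cvg_fst.
- by apply: (comp_continuous v) => ?; exact: cvg_snd.
Qed.

Lemma pullback_map_embedding :
  topological_embedding i -> topological_embedding pullback_map.
Proof.
move=> ei; have [iinj iopen] := ei; split=> [x y e|U].
  apply: val_inj; apply: injective_projections.
    exact: iinj (congr1 (fun z : pullback f' j => (val z).1) e).
  exact (congr1 (fun z : pullback f' j => (val z).2) e).
split; last first.
  case=> V oV <-; move: V oV; apply/continuousP.
  exact/pullback_map_continuous/embedding_continuous.
case=> W oW WU.
(* The largest union of open rectangles of [G' * K] that pulls back into [W];
   it pulls back onto [W] because every open set of [G] is induced by one of
   [G']. *)
pose V : set (G' * K) := [set p | exists A B,
  [/\ open A, open B, A p.1, B p.2 & (i @^-1` A) `*` B `<=` W]].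
have oV : open V.
  rewrite openE => p [A [B [oA oB Ap Bp AB]]].
  exists (A, B); first by split; exact: open_nbhs_nbhs.
  by move=> q [Aq Bq]; exists A, B.
exists (val @^-1` V); first by exists V.
rewrite -WU; apply/seteqP; split=> x /=.
  by case=> A [B [_ _ Ax Bx]]; apply.
move=> Wx; have [[A B] [/= nA nB] AB] : nbhs (val x) W.
  exact: open_nbhs_nbhs.
have [A' oA' A'A] := (iopen A°).1 (open_interior A).
exists A', B°; split=> //; first exact: open_interior.
  by have : (i @^-1` A') (val x).1 by rewrite A'A.
rewrite A'A => q [Aq Bq].
by apply: AB; split; [exact: interior_subset Aq | exact: interior_subset Bq].
Qed.

Lemma range_pullback_map :
  range pullback_map = [set y | range i (val y).1].
Proof.
apply/seteqP; split=> [_ [x _ <-]|y [g _ e]]; first by exists (val x).1.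
have fg : f g = j (val y).2 by rewrite -f'i e pullbackP.
exists (pullback_mk fg) => //.
by apply: val_inj; apply: injective_projections.
Qed.

Lemma pullback_map_normal :
  normal_subgroup (range i) -> normal_subgroup (range pullback_map).
Proof.
rewrite range_pullback_map => -[N1 NF NJ]; split=> [//|x y Nx Ny|x g Nx].
- exact: NF.
- exact: NJ.
Qed.

End PullbackMap.

Theorem theorem6p3 (G H K : topologicalGroupType)
    (f : {ghom G -> H}) (j : {ghom K -> H}) :
  semitopological_isomorphism f ->
  continuous j -> injective j ->
  semitopological_isomorphism (pullback_proj f j).
Proof.
move=> [[fbij _] [G' [i [f' [ei ni _ f'o f'i]]]]] jc _; split.
  by split; [exact: pullback_proj_bij | exact: pullback_proj_continuous].
exists (pullback f' j), (pullback_map (j := j) f'i), (pullback_proj f' j); split=> //.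
- exact: pullback_map_embedding.
- exact: pullback_map_normal.
- exact: pullback_proj_continuous.
- exact: pullback_proj_open.
Qed.
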